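(* Let $f\in\mathcal{F}^A_{c_1}(\mathbb{R}^n)$ and $g\in\mathcal{F}_{0}(\mathbb{R}^m)$ with $c_1>0$, and let $(x^k,z^k,\lambda^k)_{k=1}^N$ be generated by ADMM with step length $t>0$ from the starting points $\lambda^0\in\mathbb{R}^r$, $z^0\in\mathbb{R}^m$. If $t\leq c_1$ and $N\geq 4$, then $$\left\|Ax^N+Bz^N-b\right\|\leq \frac{\sqrt{\|\lambda^0-\lambda^\star\|^2+t^2\left\| z^0-z^\star\right\|_B^2}}{tN}.$$
   Context: Problem: $\min_{(x,z)\in\mathbb{R}^n\times\mathbb{R}^m} f(x)+g(z)$ subject to $Ax+Bz=b$, where $f:\mathbb{R}^n\to\mathbb{R}\cup\{\infty\}$ and $g:\mathbb{R}^m\to\mathbb{R}\cup\{\infty\}$ are closed proper convex functions, $0\neq A\in\mathbb{R}^{r\times n}$, $0\neq B\in\mathbb{R}^{r\times m}$, $b\in\mathbb{R}^r$. The dual objective is $D(\lambda)=\min_{(x,z)} f(x)+g(z)+\langle\lambda,Ax+Bz-b\rangle$ (value $-\infty$ if unbounded below). Standing assumptions: $(x^\star,z^\star)$ is an optimal solution of the problem with corresponding Lagrange multiplier $\lambda^\star$ (a maximizer of $D$); strong duality holds, i.e. $\max_{\lambda} D(\lambda)=\min_{Ax+Bz=b} f(x)+g(z)$; each subproblem of ADMM attains its minimum. ADMM with step length $t>0$ and starting points $\lambda^0,z^0$: for $k=1,\dots,N$, 1. $x^{k}\in\operatorname{argmin}_x f(x)+\langle\lambda^{k-1},Ax\rangle+\tfrac{t}{2}\|Ax+Bz^{k-1}-b\|^2$;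 2. $z^{k}\in\operatorname{argmin}_z g(z)+\langle\lambda^{k-1},Bz\rangle+\tfrac{t}{2}\|Ax^k+Bz-b\|^2$; 3. $\lambda^k=\lambda^{k-1}+t(Ax^k+Bz^k-b)$. Notation: $\|\cdot\|$ is the Euclidean norm; $\|x\|_A=\|Ax\|$ and $\|z\|_B=\|Bz\|$ are seminorms. $\mathcal{F}_0(\mathbb{R}^m)$ is the set of closed proper convex functions on $\mathbb{R}^m$. $\mathcal{F}^A_{c}(\mathbb{R}^n)$ is the set of closed proper functions $f$ on $\mathbb{R}^n$ that are $c$-strongly convex relative to $\|\cdot\|_A$, i.e. $f-\tfrac{c}{2}\|\cdot\|_A^2$ is convex. *)

(* Defs.v *)
From HB Require Import structures.
From mathcomp Require Import all_boot all_order all_algebra.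
From mathcomp Require Import all_classical all_reals all_analysis.

Set Implicit Arguments.
Unset Strict Implicit.
Unset Printing Implicit Defensive.

Import Order.TTheory GRing.Theory Num.Theory.
Import numFieldNormedType.Exports.

Local Open Scope classical_set_scope.
Local Open Scope ring_scope.

Section Euclidean.
Context {R : realType}.

Definition inner n (u v : 'cV[R]_n) : R := \sum_(i < n) u i 0 * v i 0.

(* The library norm [`|u|] on matrices is the sup norm. *)
Definition enorm n (u : 'cV[R]_n) : R := Num.sqrt (inner u u).

Definition seminorm_mx r n (A : 'M[R]_(r, n)) (x : 'cV[R]_n) : R :=
  enorm (A *m x).

End Euclidean.

Section ConvexAnalysis.
Context {R : realType}.
Local Open Scope ereal_scope.

(* The second factor is [R^o] to make the product an [R]-module. *)
Definition epigraph n (f : 'cV[R]_n -> \bar R) : set ('cV[R]_n * R^o) :=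
  [set p | f p.1 <= (p.2 : R)%:E].

Definition closed_fun n (f : 'cV[R]_n -> \bar R) : Prop :=
  closed (epigraph f).

Definition convex_fun n (f : 'cV[R]_n -> \bar R) : Prop :=
  convex_set (epigraph f).

(* The first clause says that f takes its values in R \cup {+oo}. *)
Definition proper_fun n (f : 'cV[R]_n -> \bar R) : Prop :=
  (forall x, f x != -oo) /\ (exists x, f x < +oo).

Definition F0 n (f : 'cV[R]_n -> \bar R) : Prop :=
  [/\ closed_fun f, proper_fun f & convex_fun f].

Definition strongly_convex_rel r n (c : R) (A : 'M[R]_(r, n))
    (f : 'cV[R]_n -> \bar R) : Prop :=
  convex_fun (fun x => f x - (c / 2 * seminorm_mx A x ^+ 2)%:E).

Definition Fc r n (c : R) (A : 'M[R]_(r, n)) (f : 'cV[R]_n -> \bar R) : Prop :=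
  [/\ closed_fun f, proper_fun f & strongly_convex_rel c A f].

Definition argmin (T : Type) (h : T -> \bar R) : set T :=
  [set x | forall y, h x <= h y].

End ConvexAnalysis.

Section Problem.
Context {R : realType} (n m r : nat).
Variables (f : 'cV[R]_n -> \bar R) (g : 'cV[R]_m -> \bar R).
Variables (A : 'M[R]_(r, n)) (B : 'M[R]_(r, m)) (b : 'cV[R]_r).
Local Open Scope ereal_scope.

Definition residual (x : 'cV[R]_n) (z : 'cV[R]_m) : 'cV[R]_r :=
  (A *m x + B *m z - b)%R.

Definition feasible : set ('cV[R]_n * 'cV[R]_m) :=
  [set p | (A *m p.1 + B *m p.2)%R = b].

Definition objective (p : 'cV[R]_n * 'cV[R]_m) : \bar R := f p.1 + g p.2.

Definition optimal_solution (x : 'cV[R]_n) (z : 'cV[R]_m) : Prop :=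
  feasible (x, z) /\ forall p, feasible p -> objective (x, z) <= objective p.

Definition dual (lam : 'cV[R]_r) : \bar R :=
  ereal_inf (range (fun p : 'cV[R]_n * 'cV[R]_m =>
    objective p + (inner lam (residual p.1 p.2))%:E)).

Definition lagrange_multiplier (lam : 'cV[R]_r) : Prop :=
  forall mu, dual mu <= dual lam.

Definition strong_duality : Prop :=
  ereal_sup (range dual) = ereal_inf (objective @` feasible).

Definition x_subproblem (t : R) (lam : 'cV[R]_r) (z : 'cV[R]_m)
    (x : 'cV[R]_n) : \bar R :=
  f x + (inner lam (A *m x) + t / 2 * enorm (residual x z) ^+ 2)%:E.

Definition z_subproblem (t : R) (lam : 'cV[R]_r) (x : 'cV[R]_n)
    (z : 'cV[R]_m) : \bar R :=
  g z + (inner lam (B *m z) + t / 2 * enorm (residual x z) ^+ 2)%:E.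

(* The starting points are [z 0] and [lam 0]; [x 0] is not used. *)
Definition ADMM (t : R) (N : nat) (x : nat -> 'cV[R]_n) (z : nat -> 'cV[R]_m)
    (lam : nat -> 'cV[R]_r) : Prop :=
  forall k : nat, (1 <= k <= N)%N ->
  [/\ argmin (x_subproblem t (lam k.-1) (z k.-1)) (x k),
      argmin (z_subproblem t (lam k.-1) (x k)) (z k)
    & lam k = (lam k.-1 + t *: residual (x k) (z k))%R].

End Problem.

(* Main.v *)
(* Write u_k = A (x_k - xs), v_k = B (z_k - zs), mu_k = (lam_k - lams) / t, and
   let F, G be f, g plus the linear terms of the Lagrangian at lams, divided by
   t, so that F and G are minimal at xs and zs; subtract the minima.  Optimality
   in the subproblems says that - (mu_k + v_(k-1) - v_k) is a subgradient of F at
   u_k and - mu_k one of G at v_k, and F is 1-strongly convex in u as t <= c1.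
   Comparing the iterates k and k+1 by these subgradient inequalities, with
   weight 2 k (k+1) in one direction and 2 k^2 in the other, shows inductively
     energy k <= |mu_0|^2 + |v_0|^2 + 2 k (F_k + G_k)   for k >= 4,
   and the comparison of iterate N with the optimal point bounds
   energy N - 2 N (F_N + G_N) below by N^2 |u_N + v_N|^2.
   The weights and the potential were found by solving the performance-estimation
   semidefinite program numerically.  Among the first four iterates F needs other
   weights, including a comparison of the fourth iterate with the first; this is
   where N >= 4 comes from. *)

Require Import Defs.
From HB Require Import structures.
From mathcomp Require Import all_boot all_order all_algebra.
From mathcomp Require Import all_classical all_reals all_analysis.
From mathcomp Require Import ring lra.

Set Implicit Arguments.
Unset Strict Implicit.
Unset Printing Implicit Defensive.

Import Order.TTheory GRing.Theory Num.Theory.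
Import numFieldNormedType.Exports.

Local Open Scope classical_set_scope.
Local Open Scope ring_scope.

(** * Bilinearity and positivity of the Euclidean inner product *)

Section InnerProduct.
Context {R : realType} (n : nat).
Implicit Types (a : R) (p q w : 'cV[R]_n).

Lemma innerC p q : inner p q = inner q p.
Proof. by apply: eq_bigr => i _; rewrite mulrC. Qed.

Lemma innerDl p q w : inner (p + q) w = inner p w + inner q w.
Proof. by rewrite -big_split; apply: eq_bigr => i _; rewrite !mxE mulrDl. Qed.

Lemma innerNl p w : inner (- p) w = - inner p w.
Proof. by rewrite -sumrN; apply: eq_bigr => i _; rewrite !mxE mulNr. Qed.

Lemma innerZl a p w : inner (a *: p) w = a * inner p w.
Proof. by rewrite mulr_sumr; apply: eq_bigr => i _; rewrite !mxE mulrA. Qed.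

Lemma innerDr p q w : inner w (p + q) = inner w p + inner w q.
Proof. by rewrite !(innerC w) innerDl. Qed.

Lemma innerNr p w : inner w (- p) = - inner w p.
Proof. by rewrite !(innerC w) innerNl. Qed.

Lemma innerZr a p w : inner w (a *: p) = a * inner w p.
Proof. by rewrite !(innerC w) innerZl. Qed.

Lemma inner_ge0 p : 0 <= inner p p.
Proof. by apply: sumr_ge0 => i _; rewrite -expr2 sqr_ge0. Qed.

Lemma enorm_sqr p : enorm p ^+ 2 = inner p p.
Proof. by rewrite sqr_sqrtr ?inner_ge0. Qed.

End InnerProduct.

Definition innerE :=
  (@innerDl, @innerDr, @innerNl, @innerNr, @innerZl, @innerZr).

Lemma mul_sqr_ge0 (R : realDomainType) (a x : R) : 0 <= a -> 0 <= a * x ^+ 2.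
Proof. by move=> a_ge0; rewrite mulr_ge0 ?sqr_ge0. Qed.

(** * Potential-function estimate for the scaled iterates *)

Section ScaledRecurrence.
Context {R : realType} (r : nat).
Variables mu u v : nat -> 'cV[R]_r.

(* At [k = 0], where [k.-1 = 0], the value is junk and never used. *)
Definition usubgrad k := - (mu k + v k.-1 - v k).

(** Lower bound on F_i - F_j given by the subgradient at iterate j and strong convexity with modulus
    1. *)
Definition ugrowth i j : R :=
  inner (usubgrad j) (u i - u j) + 2^-1 * inner (u i - u j) (u i - u j).

Definition vgrowth i j : R := inner (- mu j) (v i - v j).

(** The last bracket is the upper bound on F_k + G_k obtained by comparing iterate k with the
    optimal point. *)
Definition energy k : R :=
  k%:R ^+ 2 * inner (u k + v k) (u k + v k)
  + (k%:R - 1) ^+ 2 * inner (v k.-1 - v k) (v k.-1 - v k)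
  + 2 * k%:R * inner (v k.-1 - v k) (u k)
  + (k%:R - 2 + 4 / k%:R) * inner (u k) (u k) + inner (mu k) (mu k)
  + 2 * k%:R * (inner (usubgrad k) (u k) - 2^-1 * inner (u k) (u k)
                + inner (- mu k) (v k)).

(** Once the recurrence eliminates mu_1, ..., mu_4, the difference of the two sides is, in each
    coordinate, a weighted sum of six squares. The G weights already follow the general pattern 2 k
    (k+1), 2 k^2 for k = 1, 2, 3. *)
Lemma energy4_le :
  (forall k, (k < 4)%N -> mu k.+1 = mu k + u k.+1 + v k.+1) ->
  energy 4 <= inner (mu 0) (mu 0) + inner (v 0) (v 0)
    + 2 * ugrowth 4 1 + 6 * ugrowth 3 2 + 4 * ugrowth 2 3
    + 16 * ugrowth 4 3 + 12 * ugrowth 3 4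
    + 4 * vgrowth 2 1 + 2 * vgrowth 1 2 + 12 * vgrowth 3 2
    + 8 * vgrowth 2 3 + 24 * vgrowth 4 3 + 18 * vgrowth 3 4.
Proof.
move=> mu_rec; rewrite /energy /ugrowth /vgrowth /usubgrad /= !mu_rec // /inner.
rewrite !(mulr_sumr, =^~ sumrN, =^~ big_split) /=.
apply: ler_sum => i _; rewrite !mxE.
move: (mu 0 i 0) (v 0 i 0) (v 1 i 0) (v 2 i 0) (v 3 i 0) (v 4 i 0)
  (u 1 i 0) (u 2 i 0) (u 3 i 0) (u 4 i 0)
  => mu0 v0 v1 v2 v3 v4 u1 u2 u3 u4.
rewrite -subr_ge0 [leRHS](_ : _ = (v0 + u1 - u4) ^+ 2 + u1 ^+ 2
  + (v1 + 2 * u2 - v2 - 3 * u3 + u4) ^+ 2 + 2 * (u2 - 2^-1 * (u3 + u4)) ^+ 2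
  + 4 * (v2 - v3 + 3 / 2 * (u3 - u4)) ^+ 2 + 15 / 2 * (u3 - u4) ^+ 2).
  by rewrite !addr_ge0 ?sqr_ge0 ?mul_sqr_ge0 ?divr_ge0.
by field.
Qed.

Lemma energy_succ k : (4 <= k)%N -> mu k.+1 = mu k + u k.+1 + v k.+1 ->
  energy k.+1 <= energy k
    + 2 * k%:R * (k%:R + 1) * (ugrowth k.+1 k + vgrowth k.+1 k)
    + 2 * k%:R ^+ 2 * (ugrowth k k.+1 + vgrowth k k.+1).
Proof.
rewrite -(ler_nat R) /energy /ugrowth /vgrowth /usubgrad /= -[k.+1%:R]natr1.
move: k%:R => n n4 ->; rewrite /inner.
rewrite !(mulr_sumr, =^~ sumrN, =^~ big_split) /=.
apply: ler_sum => i _; rewrite !mxE.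
move: (mu k i 0) (v k.-1 i 0) (v k i 0) (v k.+1 i 0) (u k i 0) (u k.+1 i 0)
  => m v0 v1 v2 u1 u2.
have n_neq0 : n != 0 by apply: lt0r_neq0; lra.
have nS_neq0 : n + 1 != 0 by apply: lt0r_neq0; lra.
have nP_neq0 : n - 1 != 0 by apply: lt0r_neq0; lra.
(* Coefficient of (u1 - u2)^2 left over by the two completed squares below. In powers of n - 4 its
   numerator has positive coefficients; at n = 3 the value is -8, so this induction step cannot
   start sooner. *)
have coef_ge0 : 0 <= 3 * n ^+ 2 + n - 2 + 4 / n
    - n ^+ 2 * (n + 1) ^+ 2 / (n - 1) ^+ 2 - (n - 2) ^+ 2 * (n + 1) / n.
  pose d := n - 4; have d_ge0 : 0 <= d by rewrite /d; lra.
  rewrite [leRHS](_ : _ = (d ^+ 5 + 18 * d ^+ 4 + 119 * d ^+ 3 + 348 * d ^+ 2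
      + 398 * d + 56) / (n * (n - 1) ^+ 2)); last first.
    by rewrite /d; field; rewrite ?n_neq0 ?nS_neq0 ?nP_neq0.
  have dX_ge0 j := exprn_ge0 j d_ge0.
  apply: divr_ge0; last by apply: mul_sqr_ge0; lra.
  have := dX_ge0 5; have := dX_ge0 4; have := dX_ge0 3; have := dX_ge0 2.
  lra.
rewrite -subr_ge0 [leRHS](_ : _ =
  ((n - 1) * (v0 - v1) + n * (n + 1) / (n - 1) * (u1 - u2)) ^+ 2
  + 4 / (n * (n + 1)) * (u2 - (n - 2) * (n + 1) / 2 * (u1 - u2)) ^+ 2
  + (3 * n ^+ 2 + n - 2 + 4 / n - n ^+ 2 * (n + 1) ^+ 2 / (n - 1) ^+ 2
     - (n - 2) ^+ 2 * (n + 1) / n) * (u1 - u2) ^+ 2); last first.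
  by field; rewrite ?n_neq0 ?nS_neq0 ?nP_neq0.
rewrite !addr_ge0 ?sqr_ge0 ?mul_sqr_ge0 //.
by rewrite divr_ge0 ?mulr_ge0 //; lra.
Qed.

(** The square with weight (k-1)^2 absorbs the cross term between v_(k-1) - v_k and u_k at the cost
    (k/(k-1))^2 |u_k|^2, which the coefficient k - 2 + 4/k covers. *)
Lemma energy_residual_ge k : (4 <= k)%N ->
  k%:R ^+ 2 * inner (u k + v k) (u k + v k)
  + 2 * k%:R * (inner (usubgrad k) (u k) - 2^-1 * inner (u k) (u k)
                + inner (- mu k) (v k)) <= energy k.
Proof.
rewrite -(ler_nat R) /energy /inner; move: k%:R => n n4.
rewrite !(mulr_sumr, =^~ sumrN, =^~ big_split) /=.
apply: ler_sum => i _.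
move: (usubgrad k); rewrite !mxE => p.
move: (mu k i 0) (v k.-1 i 0) (v k i 0) (u k i 0) => m v0 v1 u1.
have n_neq0 : n != 0 by apply: lt0r_neq0; lra.
have nP_neq0 : n - 1 != 0 by apply: lt0r_neq0; lra.
have coef_ge0 : 0 <= n - 2 + 4 / n - (n / (n - 1)) ^+ 2.
  pose d := n - 4; have d_ge0 : 0 <= d by rewrite /d; lra.
  rewrite [leRHS](_ : _ = (d ^+ 4 + 11 * d ^+ 3 + 45 * d ^+ 2
      + 78 * d + 44) / (n * (n - 1) ^+ 2)); last first.
    by rewrite /d; field; rewrite ?n_neq0 ?nP_neq0.
  have dX_ge0 j := exprn_ge0 j d_ge0.
  apply: divr_ge0; last by apply: mul_sqr_ge0; lra.
  by have := dX_ge0 4; have := dX_ge0 3; have := dX_ge0 2; lra.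
rewrite -subr_ge0 [leRHS](_ : _ = ((n - 1) * (v0 - v1) + n / (n - 1) * u1) ^+ 2
  + (n - 2 + 4 / n - (n / (n - 1)) ^+ 2) * u1 ^+ 2 + m ^+ 2); last first.
  by field; rewrite ?n_neq0 ?nP_neq0.
by rewrite !addr_ge0 ?sqr_ge0 ?mul_sqr_ge0.
Qed.

Variables (N : nat) (F G : nat -> R).
Hypothesis mu_rec : forall k, (k < N)%N -> mu k.+1 = mu k + u k.+1 + v k.+1.
Hypothesis F_ge0 : forall k, (0 < k <= N)%N -> 0 <= F k.
Hypothesis G_ge0 : forall k, (0 < k <= N)%N -> 0 <= G k.
Hypothesis F_growth : forall i j, (0 < i <= N)%N -> (0 < j <= N)%N ->
  F j + ugrowth i j <= F i.
Hypothesis G_growth : forall i j, (0 < i <= N)%N -> (0 < j <= N)%N ->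
  G j + vgrowth i j <= G i.

Lemma energy_le k : (4 <= k <= N)%N ->
  energy k <= inner (mu 0) (mu 0) + inner (v 0) (v 0) + 2 * k%:R * (F k + G k).
Proof.
elim: k => // k IHk; rewrite leq_eqVlt => /andP[/predU1P[<-|k4] kN].
  have le_N i : (0 < i <= 4)%N -> (0 < i <= N)%N.
    by case/andP=> -> /leq_trans ->.
  have Fij i j (i4 : (0 < i <= 4)%N) (j4 : (0 < j <= 4)%N) :=
    F_growth (le_N i i4) (le_N j j4).
  have Gij i j (i4 : (0 < i <= 4)%N) (j4 : (0 < j <= 4)%N) :=
    G_growth (le_N i i4) (le_N j j4).
  have F0 i (i4 : (0 < i <= 4)%N) := F_ge0 (le_N i i4).
  have G0 i (i4 : (0 < i <= 4)%N) := G_ge0 (le_N i i4).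
  (* With these weights the differences of F sum to 6 F_4 - 2 (F_1 + F_2 + F_3), and likewise for G;
     nonnegativity bounds this by 8 F_4, where 8 = 2 k at k = 4. *)
  have := energy4_le (fun k k4 => mu_rec (leq_trans k4 kN)).
  have := Fij 4 1 isT isT; have := Fij 3 2 isT isT; have := Fij 2 3 isT isT.
  have := Fij 4 3 isT isT; have := Fij 3 4 isT isT.
  have := Gij 2 1 isT isT; have := Gij 1 2 isT isT; have := Gij 3 2 isT isT.
  have := Gij 2 3 isT isT; have := Gij 4 3 isT isT; have := Gij 3 4 isT isT.
  have := F0 1 isT; have := F0 2 isT; have := F0 3 isT; have := F0 4 isT.
  have := G0 1 isT; have := G0 2 isT; have := G0 3 isT; have := G0 4 isT.
  lra.
have k_gt3 : (3 < k)%N by [].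
have k_ltN : (0 < k <= N)%N.
  by apply/andP; split; [apply: leq_trans k_gt3 | apply: ltnW].
have kS_ltN : (0 < k.+1 <= N)%N := kN.
have := energy_succ k_gt3 (mu_rec kN).
have := IHk; rewrite k_gt3 (ltnW kN) => /(_ isT).
have up : ugrowth k.+1 k + vgrowth k.+1 k <= F k.+1 + G k.+1 - (F k + G k).
  by have := F_growth kS_ltN k_ltN; have := G_growth kS_ltN k_ltN; lra.
have dn : ugrowth k k.+1 + vgrowth k k.+1 <= F k + G k - (F k.+1 + G k.+1).
  by have := F_growth k_ltN kS_ltN; have := G_growth k_ltN kS_ltN; lra.
have k_ge0 : 0 <= k%:R :> R by [].
have cu : 0 <= 2 * k%:R * (k%:R + 1) :> R by rewrite !mulr_ge0 ?addr_ge0.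
have cd : 0 <= 2 * k%:R ^+ 2 :> R by rewrite mulr_ge0 ?sqr_ge0.
(* The weights differ by 2 k, so the sum is 2 k times the increase of F + G. This turns 2 k (F_k +
   G_k) into 2 k (F_(k+1) + G_(k+1)), and nonnegativity raises the factor to 2 (k+1). *)
have := ler_wpM2l cu up; have := ler_wpM2l cd dn.
have := F_ge0 kS_ltN; have := G_ge0 kS_ltN.
rewrite -[k.+1%:R]natr1; move: k%:R {up dn cu cd} k_ge0 => n; lra.
Qed.

(** The two inequalities are the growth estimates from iterate N to the optimal point, where u, v
    and both gaps vanish. They bound 2 N (F_N + G_N) by the last term of [energy N], which then
    cancels. *)
Lemma residual_bound : (4 <= N)%N ->
  F N + (inner (usubgrad N) (- u N) + 2^-1 * inner (u N) (u N)) <= 0 ->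
  G N + inner (- mu N) (- v N) <= 0 ->
  N%:R ^+ 2 * inner (u N + v N) (u N + v N)
  <= inner (mu 0) (mu 0) + inner (v 0) (v 0).
Proof.
move=> N4 Fs Gs.
have := energy_residual_ge N4.
have := energy_le (k := N); rewrite N4 leqnn => /(_ isT).
have : 2 * N%:R * (F N + G N) <= 2 * N%:R * (inner (usubgrad N) (u N)
    - 2^-1 * inner (u N) (u N) + inner (- mu N) (v N)).
  by apply: ler_wpM2l; [rewrite mulr_ge0 | move: Fs Gs; rewrite !innerNr; lra].
lra.
Qed.

End ScaledRecurrence.

(** * Subgradient inequalities at minimizers *)

Lemma lin_coef_ge0 (R : realFieldType) (a b : R) :
  (forall s, 0 < s -> s <= 1 -> 0 <= a * s + b * s ^+ 2) -> 0 <= a.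
Proof.
move=> quad_ge0; rewrite leNgt; apply/negP => a_lt0.
(* The test point s = - a / (|b| + 1 - a) lies in (0, 1] and is small enough that a < 0 would force
   a + b s < 0. *)
have d_gt0 : 0 < `|b| + 1 - a by have := normr_ge0 b; lra.
have s_gt0 : 0 < - a / (`|b| + 1 - a) by rewrite divr_gt0 ?oppr_gt0.
have s_le1 : - a / (`|b| + 1 - a) <= 1.
  by rewrite ler_pdivrMr // mul1r; have := normr_ge0 b; lra.
have := quad_ge0 _ s_gt0 s_le1.
rewrite expr2 [b * _]mulrA -mulrDl pmulr_lge0 // => /mulr_ge0 /(_ (ltW d_gt0)).
rewrite mulrDl -mulrA divfK ?lt0r_neq0 //.
have := ler_norm b; nra.
Qed.

Section StrongConvexity.
Context {R : realType} (r n : nat).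
Variables (c : R) (A : 'M[R]_(r, n)) (f : 'cV[R]_n -> \bar R).
Hypothesis f_convex : strongly_convex_rel c A f.

Lemma strongly_convex_rel_segment x y (s : R) :
  f x \is a fin_num -> f y \is a fin_num -> 0 <= s -> s <= 1 ->
  (f (x + s *: (y - x)) <= ((1 - s) * fine (f x) + s * fine (f y)
     - c / 2 * s * (1 - s) * inner (A *m y - A *m x) (A *m y - A *m x))%:E)%E.
Proof.
move=> fx fy s_ge0 s_le1.
pose S : {i01 R} := Itv01 s_ge0 s_le1.
pose E z := fine (f z) - c / 2 * seminorm_mx A z ^+ 2.
have epi z : f z \is a fin_num ->
    (z, E z) \in
      epigraph (fun w => (f w - (c / 2 * seminorm_mx A w ^+ 2)%:E)%E).
  by move=> fz; rewrite inE /epigraph /= /E EFinB fineK.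
(* The point y comes first because the convex combination gives weight s to its first argument. *)
have := f_convex S (epi _ fy) (epi _ fx); rewrite inE /epigraph /=.
have -> : s *: y + (1 - s) *: x = x + s *: (y - x).
  by rewrite scalerBl scale1r scalerBr addrCA addrA.
rewrite EFinN leeBlDr // -EFinD => /le_trans; apply; rewrite lee_fin.
rewrite /E /seminorm_mx !enorm_sqr mulmxDr -scalemxAr mulmxBr !innerE.
rewrite (innerC (A *m y) (A *m x)) le_eqVlt; apply/orP; left; apply/eqP.
rewrite /GRing.scale /= /unstable.onem; by field.
Qed.

(** First-order optimality without derivatives: minimality of x against x + s (y - x), with strong
    convexity on the segment, gives a quadratic in s without constant term. Its linear coefficient
    is the claim, and (a + c) / 2 in the s^2 term collects the penalty and the modulus. *)
Lemma argmin_growth (l d : 'cV[R]_r) (a : R) x y :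
  f x \is a fin_num -> f y \is a fin_num ->
  argmin (fun w => (f w + (inner l (A *m w)
    + a / 2 * inner (A *m w - d) (A *m w - d))%:E)%E) x ->
  fine (f x) - inner (l + a *: (A *m x - d)) (A *m y - A *m x)
    + c / 2 * inner (A *m y - A *m x) (A *m y - A *m x) <= fine (f y).
Proof.
move=> fx fy x_min; rewrite -subr_ge0.
set D := inner (A *m y - A *m x) (A *m y - A *m x).
apply: (@lin_coef_ge0 _ _ ((a + c) / 2 * D)) => s s_gt0 s_le1.
have := x_min (x + s *: (y - x)).
have := strongly_convex_rel_segment fx fy (ltW s_gt0) s_le1.
rewrite -/D; set h := fun w => inner l (A *m w)
    + a / 2 * inner (A *m w - d) (A *m w - d).
rewrite -/(h _) -/(h x) => /(leeD2r (h (x + s *: (y - x)))%:E) fs.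
move=> /le_trans /(_ fs).
rewrite -(fineK fx) -!EFinD lee_fin /h /D mulmxDr -scalemxAr mulmxBr !innerE.
rewrite (innerC (A *m y) (A *m x)) (innerC d (A *m x)) (innerC d (A *m y)).
rewrite -subr_ge0 => h_ge0; apply: (le_trans h_ge0).
rewrite le_eqVlt; apply/orP; left; apply/eqP; by field.
Qed.

End StrongConvexity.

Lemma argmin_fin_num (R : realType) (T : Type) (f : T -> \bar R) (h : T -> R)
    x :
  (forall y, f y != -oo%E) -> (exists y, f y < +oo)%E ->
  argmin (fun y => (f y + (h y)%:E)%E) x -> f x \is a fin_num.
Proof.
move=> f_ninfty [y fy] /(_ y) fx_le; rewrite fin_numE f_ninfty /= -ltey.
have : (f x + (h x)%:E < +oo)%E.
  by rewrite (le_lt_trans fx_le) ?lte_add_pinfty ?ltry.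
by rewrite !ltey; case: (f x).
Qed.

(** Modulus 0 lets g be treated by the same growth lemma as f. *)
Lemma convex_fun_rel0 (R : realType) (r n : nat) (A : 'M[R]_(r, n))
    (f : 'cV[R]_n -> \bar R) : convex_fun f -> strongly_convex_rel 0 A f.
Proof.
rewrite /strongly_convex_rel; congr convex_fun.
by apply/funext => x; rewrite !mul0r sube0.
Qed.

(** * Saddle-point property of the optimal pair and its multiplier *)

Section SaddlePoint.
Context {R : realType} (n m r : nat).
Variables (f : 'cV[R]_n -> \bar R) (g : 'cV[R]_m -> \bar R).
Variables (A : 'M[R]_(r, n)) (B : 'M[R]_(r, m)) (b : 'cV[R]_r).
Variables (xs : 'cV[R]_n) (zs : 'cV[R]_m) (lams : 'cV[R]_r).
Hypotheses (f_proper : proper_fun f) (g_proper : proper_fun g).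
Hypothesis opt : optimal_solution f g A B b xs zs.
Hypothesis mult : lagrange_multiplier f g A B b lams.
Hypothesis duality : strong_duality f g A B b.

(** The optimal value equals the dual value at [lams], which is an infimum of the Lagrangian. *)
Lemma optimal_le_lagrangian y w :
  (f xs + g zs <= f y + g w + (inner lams (residual A B b y w))%:E)%E.
Proof.
have opt_le : (f xs + g zs <= ereal_inf (objective f g @` feasible A B b))%E.
  by apply: le_ereal_inf_tmp => _ [p p_feas <-]; apply: opt.2.
apply: (le_trans opt_le); rewrite -duality.
apply: (@le_trans _ _ (dual f g A B b lams)).
  by apply: ge_ereal_sup => _ [nu _ <-]; apply: mult.
by apply: ereal_inf_lbound; exists (y, w).
Qed.

(** The Lagrangian is finite at any pair of domain points, feasible or not, and bounds the optimal
    value. *)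
Lemma optimal_fin_num : f xs \is a fin_num /\ g zs \is a fin_num.
Proof.
have [[f_ninfty [y fy]] [g_ninfty [w gw]]] := (f_proper, g_proper).
have : (f xs + g zs < +oo)%E.
  apply: le_lt_trans (optimal_le_lagrangian y w) _.
  by rewrite !lte_add_pinfty ?ltry.
rewrite ltey; move: (f_ninfty xs) (g_ninfty zs).
by case: (f xs) => [?||]; case: (g zs) => [?||].
Qed.

Lemma optimal_argmin_l :
  argmin (fun y => (f y + (inner lams (A *m y))%:E)%E) xs.
Proof.
have [fxs gzs] := optimal_fin_num; move=> y.
have := optimal_le_lagrangian y zs; rewrite addeAC leeD2rE //.
move=> /(leeD2r (inner lams (A *m xs))%:E) /le_trans; apply.
rewrite -addeA -EFinD -innerDr /residual.
have <- : A *m xs + B *m zs = b by case: opt.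
by rewrite opprD addrA addrAC subrK addrK.
Qed.

Lemma optimal_argmin_r :
  argmin (fun w => (g w + (inner lams (B *m w))%:E)%E) zs.
Proof.
have [fxs gzs] := optimal_fin_num; move=> w.
have := optimal_le_lagrangian xs w; rewrite -addeA leeD2lE //.
move=> /(leeD2r (inner lams (B *m zs))%:E) /le_trans; apply.
rewrite -addeA -EFinD -innerDr /residual.
have <- : A *m xs + B *m zs = b by case: opt.
by rewrite opprD addrA subrK addrAC subrr add0r.
Qed.

End SaddlePoint.

(** * Reduction of ADMM to the scaled recurrence *)

(** Dividing by t turns modulus c into c / t, hence at least c0. The x-step uses c0 = 1, where t <=
    c enters, and the z-step uses c = c0 = 0. *)
Lemma scaled_argmin_growth (R : realType) (r n : nat) (c c0 t : R)
    (A : 'M[R]_(r, n)) (f : 'cV[R]_n -> \bar R) (l d nu : 'cV[R]_r) x y :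
  strongly_convex_rel c A f -> 0 < t -> t * c0 <= c ->
  f x \is a fin_num -> f y \is a fin_num ->
  argmin (fun w => (f w + (inner l (A *m w)
    + t / 2 * enorm (A *m w - d) ^+ 2)%:E)%E) x ->
  t^-1 * (fine (f x) + inner nu (A *m x))
    + (inner (- (t^-1 *: (l + t *: (A *m x - d) - nu))) (A *m y - A *m x)
       + c0 / 2 * inner (A *m y - A *m x) (A *m y - A *m x))
  <= t^-1 * (fine (f y) + inner nu (A *m y)).
Proof.
move=> f_convex t_gt0 tc0 fx fy x_min.
have : argmin (fun w => (f w + (inner l (A *m w)
    + t / 2 * inner (A *m w - d) (A *m w - d))%:E)%E) x.
  by move=> w; have := x_min w; rewrite !enorm_sqr.
move=> /(argmin_growth f_convex fx fy).
have -> : inner nu (A *m y) = inner nu (A *m x) + inner nu (A *m y - A *m x).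
  by rewrite innerDr innerNr; ring.
set q := A *m y - A *m x; set p := l + _ => growth.
have t_neq0 : t != 0 by exact: lt0r_neq0.
rewrite !innerNl innerZl innerDl innerNl -(ler_pM2l t_gt0) !mulrDr.
rewrite !(mulrN, mulrDr, mulVKf t_neq0).
have := ler_wpM2r (inner_ge0 q) tc0; lra.
Qed.

Lemma residual_sqr_le (R : realType) (n m r : nat)
    (f : 'cV[R]_n -> \bar R) (g : 'cV[R]_m -> \bar R)
    (A : 'M[R]_(r, n)) (B : 'M[R]_(r, m)) (b : 'cV[R]_r) (c t : R) (N : nat)
    (xs : 'cV[R]_n) (zs : 'cV[R]_m) (lams : 'cV[R]_r)
    (x : nat -> 'cV[R]_n) (z : nat -> 'cV[R]_m) (lam : nat -> 'cV[R]_r) :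
  Fc c A f -> F0 g -> optimal_solution f g A B b xs zs ->
  lagrange_multiplier f g A B b lams -> strong_duality f g A B b ->
  0 < t -> t <= c -> ADMM f g A B b t N x z lam -> (4 <= N)%N ->
  (t * N%:R) ^+ 2 * enorm (residual A B b (x N) (z N)) ^+ 2
  <= enorm (lam 0%N - lams) ^+ 2 + t ^+ 2 * seminorm_mx B (z 0%N - zs) ^+ 2.
Proof.
move=> [_ f_proper f_convex] [_ g_proper /(@convex_fun_rel0 _ _ _ B) g_convex].
move=> opt mult duality t_gt0 t_le_c iter N_ge4.
have [fxs gzs] := optimal_fin_num f_proper g_proper opt mult duality.
have t_neq0 : t != 0 by exact: lt0r_neq0.
have feas : A *m xs + B *m zs = b by case: opt.
have fx k : (0 < k <= N)%N -> f (x k) \is a fin_num.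
  by move=> /iter[x_min _ _]; apply: argmin_fin_num x_min; case: f_proper.
have gz k : (0 < k <= N)%N -> g (z k) \is a fin_num.
  by move=> /iter[_ z_min _]; apply: argmin_fin_num z_min; case: g_proper.
pose mu k := t^-1 *: (lam k - lams).
pose u k := A *m x k - A *m xs.
pose v k := B *m z k - B *m zs.
pose Fv y := t^-1 * (fine (f y) + inner lams (A *m y)).
pose Gv w := t^-1 * (fine (g w) + inner lams (B *m w)).
have xs_min y : f y \is a fin_num -> Fv xs <= Fv y.
  move=> fy; rewrite ler_pM2l ?invr_gt0 // -lee_fin !EFinD !fineK //.
  exact: (optimal_argmin_l f_proper g_proper opt mult duality).
have zs_min w : g w \is a fin_num -> Gv zs <= Gv w.
  move=> gw; rewrite ler_pM2l ?invr_gt0 // -lee_fin !EFinD !fineK //.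
  exact: (optimal_argmin_r f_proper g_proper opt mult duality).
have F_growth k y : (0 < k <= N)%N -> f y \is a fin_num ->
    Fv (x k) + (inner (usubgrad mu v k) (A *m y - A *m x k)
      + 2^-1 * inner (A *m y - A *m x k) (A *m y - A *m x k)) <= Fv y.
  move=> kN fy; have [x_min _ lam_k] := iter k kN.
  (* The x-step sees the old z, so its multiplier is lam_k + t (v_(k-1) - v_k) rather than lam_k. *)
  have -> : usubgrad mu v k = - (t^-1 *: (lam k.-1
      + t *: (A *m x k - (b - B *m z k.-1)) - lams)).
    rewrite /usubgrad /mu /v lam_k /residual.
    move: (A *m _) (B *m z k) (B *m z k.-1) (B *m zs) => a bk bp bs.
    by apply/colP => i; rewrite !mxE; field.
  rewrite -[2^-1]mul1r /Fv; apply: (@scaled_argmin_growth _ _ _ c 1) => //.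
  - by rewrite mulr1.
  - exact: fx.
  - by move=> w; have := x_min w; rewrite /x_subproblem /residual !opprB !addrA.
have G_growth k w : (0 < k <= N)%N -> g w \is a fin_num ->
    Gv (z k) + inner (- mu k) (B *m w - B *m z k) <= Gv w.
  move=> kN gw; have [_ z_min lam_k] := iter k kN.
  have -> : mu k = t^-1 *: (lam k.-1 + t *: (B *m z k - (b - A *m x k)) - lams).
    by rewrite /mu lam_k /residual opprB addrCA addrA.
  set q := B *m w - B *m z k.
  (* A vanishing quadratic term gives the goal the shape of the growth lemma with c0 = 0. *)
  have -> p : inner p q = inner p q + 0 / 2 * inner q q by rewrite !mul0r addr0.
  rewrite /Gv; apply: (@scaled_argmin_growth _ _ _ 0 0) => //.
  - by rewrite mulr0.
  - exact: gz.
  - move=> y; have := z_min y.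
    by rewrite /z_subproblem /residual !opprB ![B *m _ + _]addrCA !addrA.
have NN : (0 < N <= N)%N by rewrite leqnn (leq_trans _ N_ge4).
have res k : u k + v k = residual A B b (x k) (z k).
  by rewrite /u /v /residual -feas addrACA -opprD.
have subB p q w : (p - w) - (q - w) = p - q :> 'cV[R]_r.
  by rewrite opprB addrA subrK.
have bound : N%:R ^+ 2 * inner (u N + v N) (u N + v N)
    <= inner (mu 0) (mu 0) + inner (v 0) (v 0).
  apply: (@residual_bound _ _ mu u v N (fun k => Fv (x k) - Fv xs)
    (fun k => Gv (z k) - Gv zs)) => // [k kN|k kN|k kN|i j iN jN|i j iN jN||].
  - have [_ _ lam_k] := iter k.+1 kN.
    by rewrite -addrA res /mu lam_k addrAC scalerDr scalerA mulVf ?scale1r.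
  - by rewrite subr_ge0 xs_min ?fx.
  - by rewrite subr_ge0 zs_min ?gz.
  - by rewrite /ugrowth subB addrAC lerB ?F_growth ?fx.
  - by rewrite /vgrowth subB addrAC lerB ?G_growth ?gz.
  - have := F_growth N xs NN fxs.
    rewrite -(opprB (A *m x N)) -/(u N) [inner (- u N) _]innerNl !innerNr opprK.
    lra.
  - have := G_growth N zs NN gzs.
    by rewrite -(opprB (B *m z N)) -/(v N) => ?; lra.
rewrite -res !enorm_sqr exprMn -mulrA.
(* The factor t^2 undoes the scaling mu_0 = (lam_0 - lams) / t. *)
apply: (le_trans (ler_wpM2l (sqr_ge0 t) bound)).
rewrite mulrDr mulmxBr lerD2r /mu innerZl innerZr.
by rewrite expr2 -mulrA !mulVKf.
Qed.

Theorem theorem4 (R : realType) (n m r : nat)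
    (f : 'cV[R]_n -> \bar R) (g : 'cV[R]_m -> \bar R)
    (A : 'M[R]_(r, n)) (B : 'M[R]_(r, m)) (b : 'cV[R]_r) (c1 t : R) (N : nat)
    (xs : 'cV[R]_n) (zs : 'cV[R]_m) (lams : 'cV[R]_r)
    (x : nat -> 'cV[R]_n) (z : nat -> 'cV[R]_m) (lam : nat -> 'cV[R]_r)
    (A_neq0 : A != 0) (B_neq0 : B != 0)
    (c1_gt0 : 0 < c1) (hf : Fc c1 A f) (hg : F0 g)
    (opt : optimal_solution f g A B b xs zs)
    (mult : lagrange_multiplier f g A B b lams)
    (duality : strong_duality f g A B b)
    (t_gt0 : 0 < t) (iter : ADMM f g A B b t N x z lam)
    (t_le_c1 : t <= c1) (N_ge4 : (4 <= N)%N) :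
  enorm (A *m x N + B *m z N - b) <=
    Num.sqrt (enorm (lam 0%N - lams) ^+ 2
              + t ^+ 2 * seminorm_mx B (z 0%N - zs) ^+ 2) / (t * N%:R).
Proof.
have tN_gt0 : 0 < t * N%:R by rewrite mulr_gt0 // ltr0n (leq_trans _ N_ge4).
rewrite ler_pdivlMr //; set e := enorm _.
have e_ge0 : 0 <= e * (t * N%:R) by rewrite mulr_ge0 ?sqrtr_ge0 // ltW.
rewrite -(ger0_norm e_ge0) -sqrtr_sqr ler_wsqrtr // mulrC exprMn.
exact: residual_sqr_le hf hg opt mult duality t_gt0 t_le_c1 iter N_ge4.
Qed.
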